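(* Let $k\ge 2$. A maximal 2-subgroup of $\mathrm{Aut}\,X^{[k]}$ that acts by even permutations on $X^k$ has the structure of the semidirect product $G_k\simeq B_{k-1}\ltimes W_{k-1}$, and it is isomorphic to a Sylow 2-subgroup of the alternating group $A_{2^k}$.
   Context: Let $X=\{0,1\}$ and let $X^{[k]}$ be the finite rooted binary tree with levels $X^0,\ldots,X^k$ ($X^l$ = words of length $l$; $v$ is joined to $vx$, $x\in X$). For $g\in \mathrm{Aut}\,X^{[k]}$ and a vertex $v$ of level $<k$, the section $g_{(v)}$ is defined by $g(vx)=g(v)g_{(v)}(x)$; its action on the first level below $v$ is the vertex permutation (v.p.) of $g$ at $v$, called active if it is nontrivial. $B_{k-1}=\mathrm{Aut}\,X^{[k-1]}\simeq C_2\wr\cdots\wr C_2$ ($k-1$ factors) is viewed as the subgroup of $\mathrm{Aut}\,X^{[k]}$ of automorphisms having trivial v.p. at all vertices of $X^{k-1}$. $W_{k-1}$ is the subgroup of $\mathrm{Aut}\,X^{[k]}$ of automorphisms whose active v.p.'s all lie on $X^{k-1}$ and are even in number. In the semidirect product, $B_{k-1}$ acts on $W_{k-1}$ by conjugation inside $\mathrm{Aut}\,X^{[k]}$. ''Maximal'' means maximal among the 2-subgroups of $\mathrm{Aut}\,X^{[k]}$ all of whose elements induce even permutations of the set $X^k$. *)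

(* Defs.v *)
From mathcomp Require Import all_boot all_fingroup all_solvable.

Set Implicit Arguments.
Unset Strict Implicit.
Unset Printing Implicit Defensive.

(* The vertices of X^[k]: the words of length at most k over X = {0,1}. *)
Notation vertex k := (k.-bseq bool).

Section BinaryTree.

Variable k : nat.
Implicit Types (u v : vertex k) (w : seq bool) (x : bool).
Implicit Types g h : {perm vertex k}.

Definition child u v : bool := [exists x, v == rcons u x :> seq bool].

Definition adj u v : bool := child u v || child v u.

Definition level (l : nat) : {set vertex k} := [set v : vertex k | size v == l].

Definition Aut_tree : {set {perm vertex k}} :=
  [set g : {perm vertex k} | (g [bseq] == [bseq]) && [forall u, forall v, adj (g u) (g v) == adj u v]].

Lemma Aut_tree_group_set : group_set Aut_tree.
Proof.
apply/group_setP; split.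
  rewrite inE perm1 eqxx /=; apply/forallP=> u; apply/forallP=> v.
  by rewrite !perm1.
move=> g h; rewrite !inE => /andP[/eqP g0 /'forall_forallP gA].
move=> /andP[/eqP h0 /'forall_forallP hA].
rewrite permM g0 h0 eqxx /=; apply/'forall_forallP=> u v.
by rewrite !permM (eqP (hA _ _)).
Qed.

Canonical Aut_tree_group := group Aut_tree_group_set.

(* The section of g at v, determined by g (v w) = g v (section g v w) whenever
   v w is a vertex (see Aut_tree_section); insub_bseq only turns the word v w
   into a vertex. *)
Definition section g v w : seq bool :=
  drop (size v) (g (insub_bseq k (v ++ w))).

Lemma val_insub_vertex w :
  size w <= k -> insub_bseq k w = w :> seq bool.
Proof. by move=> sw; rewrite /insub_bseq /insubd insubT. Qed.

Lemma insub_vertexK u : insub_bseq k u = u.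
Proof. by apply: val_inj; apply: val_insub_vertex (size_bseq u). Qed.

Lemma Aut_tree_child g u v :
  g \in Aut_tree -> child u v -> child (g u) (g v).
Proof.
rewrite inE => /andP[/eqP g0 /'forall_forallP gA].
have [n] := ubnP (size u); elim: n u v => // n IH u v le_u uv.
have: adj (g u) (g v) by rewrite (eqP (gA _ _)) /adj uv.
case/orP=> // /existsP[y /eqP gu].
have [s def_u] : exists s, u = s :> seq bool by exists u.
case/lastP: s def_u => [|p z] def_u.
  have u0 : u = [bseq] by apply: val_inj; exact: def_u.
  by move: gu; rewrite u0 g0; case: (g v : seq bool).
have sp : size p <= k.
  by apply: leq_trans (size_bseq u); rewrite def_u size_rcons.
pose p' := insub_bseq k p.
have p'E : p' = p :> seq bool by apply: val_insub_vertex.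
have pu : child p' u by apply/existsP; exists z; rewrite p'E def_u.
have /(IH p' u) : size p' < n by move: le_u; rewrite p'E def_u size_rcons.
case/(_ pu)/existsP=> t /eqP gu'.
have gpv : g p' = g v.
  apply: val_inj; move: gu'; rewrite gu => /eqP.
  by rewrite eqseq_rcons => /andP[/eqP/esym].
have /(congr1 (fun q : vertex k => size q)) := perm_inj gpv.
case/existsP: uv => x /eqP->; rewrite size_rcons p'E def_u size_rcons.
by move/eqP; rewrite ltn_eqF // ltnS leqnSn.
Qed.

Lemma Aut_tree_section g v w :
  g \in Aut_tree -> size v + size w <= k ->
  [/\ size (g v) = size v, size (section g v w) = size w
    & g (insub_bseq k (v ++ w)) = g v ++ section g v w :> seq bool].
Proof.
move=> gA.
have cat_g u w' : size u + size w' <= k -> exists2 t,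
    size t = size w' & g (insub_bseq k (u ++ w')) = g u ++ t :> seq bool.
  elim/last_ind: w' => [|w' x IH] sk.
    by exists [::]; rewrite // !cats0 insub_vertexK.
  have sk1 : size u + size w' < k by rewrite size_rcons addnS in sk.
  have [t st gt] := IH (ltnW sk1).
  have: child (insub_bseq k (u ++ w')) (insub_bseq k (u ++ rcons w' x)).
    apply/existsP; exists x; rewrite !val_insub_vertex ?size_cat //.
      by rewrite rcons_cat.
    exact: ltnW.
  case/(Aut_tree_child gA)/existsP=> y /eqP->.
  by exists (rcons t y); rewrite ?size_rcons ?st // gt rcons_cat.
have size_g u : size (g u) = size u.
  have [t st] := cat_g [bseq] u (size_bseq u).
  rewrite insub_vertexK.
  by move: gA; rewrite inE => /andP[/eqP-> _] ->; rewrite /= st.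
move=> sk; have [t st gt] := cat_g v w sk.
by rewrite /section gt -(size_g v) drop_size_cat.
Qed.

(* The vertex permutation of g at v is x |-> section g v [:: x]; vertices of
   level k carry none. *)
Definition active g v : bool :=
  (size v < k) && [exists x, section g v [:: x] != [:: x]].

Definition active_set g : {set vertex k} := [set v : vertex k | active g v].

(* Aut X^[k-1], viewed inside Aut X^[k]. *)
Definition B_sub : {set {perm vertex k}} :=
  [set g : {perm vertex k} in Aut_tree | [forall v in level k.-1, ~~ active g v]].

Definition W_sub : {set {perm vertex k}} :=
  [set g : {perm vertex k} in Aut_tree |
     (active_set g \subset level k.-1) && ~~ odd #|active_set g|].

(* restr_perm (level k) g is the permutation that g induces on X^k, extended by
   the identity to the other vertices, which does not change its parity;
   elements of Aut_tree preserve level k. *)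
Definition even_on_leaves g : bool := ~~ odd_perm (restr_perm (level k) g).

Definition even_2subgroup (G : {set {perm vertex k}}) : bool :=
  [&& G \subset Aut_tree, (2.-group G)%g & [forall g in G, even_on_leaves g]].

End BinaryTree.

(* Main.v *)
Require Import Defs.
From mathcomp Require Import all_boot all_fingroup all_solvable.

Set Implicit Arguments.
Unset Strict Implicit.
Unset Printing Implicit Defensive.

(** An automorphism of the tree is determined by its active vertices, and any
    set of vertices of level less than k is the set of active vertices of some
    automorphism (portraitK, active_set_portrait). As there are 2 ^ k - 1 such
    vertices, Aut X^[k] has order 2 ^ (2 ^ k - 1) and is a 2-group.

    Its elements acting evenly on the leaves form a subgroup, even_Aut, which
    contains every 2-subgroup acting evenly: so it is the only maximal one, and
    both assertions are about it. It has index 2, as one active vertex on level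
    k - 1 swaps just two leaves.

    For the semidirect product, write an even automorphism g as w * b, where b
    has the active vertices of g that lie above level k - 1. Then b agrees with
    g on level k - 1, so w fixes that level. An automorphism that fixes level
    k - 1 is a product of disjoint transpositions of sibling leaves, one for
    each active vertex (odd_portrait), so it is even exactly when it is in
    W_{k-1}; hence W_{k-1} is the pointwise stabiliser of level k - 1 in
    even_Aut, and it is normal. The factor B_{k-1} is the stabiliser of the set
    of leaves ending in false, hence a group; it acts in the same way on the
    leaves ending in false and on those ending in true, so it acts evenly
    (B_sub_even). Both factors lie in even_Aut, and they intersect trivially
    because no vertex can be active for an element of both.

    For the Sylow subgroup, even_Aut acts faithfully on the 2 ^ k leaves by even
    permutations, and its order 2 ^ (2 ^ k - 2) is the 2-part of (2 ^ k)! / 2,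
    because the exponent of 2 in (2 ^ k)! is the sum of the 2 ^ i for i < k. *)

Section Portraits.

Variable k : nat.
Implicit Types (u v : vertex k) (w : seq bool) (x : bool).
Implicit Types (g h : {perm vertex k}) (A : {set vertex k}).

(** * Action on the children of a vertex *)

(** The child of v along the letter x; the value is junk when v is a leaf. *)
Definition ext v x : vertex k := insub_bseq k (rcons v x).

Lemma val_ext v x : size v < k -> ext v x = rcons v x :> seq bool.
Proof. by move=> sv; rewrite val_insub_vertex ?size_rcons. Qed.

Lemma ext_inj u v x y :
  size u < k -> size v < k -> ext u x = ext v y -> u = v /\ x = y.
Proof.
move=> su sv /(congr1 (fun z : vertex k => z : seq bool)).
by rewrite !val_ext // => /rcons_inj[/val_inj -> ->].
Qed.

Lemma vertex_ind (P : vertex k -> Prop) :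
  P [bseq] -> (forall v x, size v < k -> P v -> P (ext v x)) -> forall u, P u.
Proof.
move=> P0 PS u; rewrite -(insub_vertexK u).
have := size_bseq u; elim/last_ind: (u : seq bool) => [|w x IH] sw.
  rewrite (_ : insub_bseq k [::] = [bseq] :> vertex k) //.
  by apply: val_inj; rewrite /= val_insub_vertex.
rewrite size_rcons in sw; have := PS (insub_bseq k w) x.
rewrite /ext val_insub_vertex ?(ltnW sw) //; apply=> //.
exact/IH/ltnW.
Qed.

Lemma Aut_size g v : g \in Aut_tree k -> size (g v) = size v.
Proof.
by move=> gA; case: (@Aut_tree_section k g v [::] gA); rewrite ?addn0 ?size_bseq.
Qed.

Lemma Aut_root g : g \in Aut_tree k -> g [bseq] = [bseq].
Proof. by rewrite inE => /andP[/eqP]. Qed.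

(** A vertex permutation is a permutation of two letters, hence it is the
    addition of a bit, and that bit tells whether it is active. *)
Lemma Aut_ext g v x : g \in Aut_tree k -> size v < k ->
  g (ext v x) = ext (g v) (x (+) active g v).
Proof.
move=> gA sv.
have sec y : exists2 z, Defs.section g v [:: y] = [:: z]
    & g (ext v y) = ext (g v) z.
  case: (@Aut_tree_section k g v [:: y] gA); first by rewrite addn1.
  case: (Defs.section g v [:: y]) => [|z [|? ?]] //= sgv _ E.
  exists z => //; apply: val_inj; rewrite /= val_ext ?sgv // -cats1 -E.
  by rewrite /ext cats1.
have [a sa ga] := sec true; have [b sb gb] := sec false.
have ab : a != b.
  apply/eqP=> eab; have /perm_inj/ext_inj[]// : g (ext v true) = g (ext v false).
  by rewrite ga gb eab.
have -> : active g v = ~~ a.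
  rewrite /active sv; apply/existsP/idP => [[[]]|na].
  - by rewrite sa; case: (a).
  - by rewrite sb; case: (a) (b) ab => [] [].
  - by exists true; rewrite sa; case: (a) na.
by case: x; rewrite ?ga ?gb; case: (a) (b) ab => [] [].
Qed.

(** Such a g preserves adjacency by construction. It also reflects it: if g v is
    a child of g u, then v is a child of some w with g w = g u, so w = u. *)
Lemma Aut_treeI g (c : pred (vertex k)) :
    g [bseq] = [bseq] ->
    (forall v x, size v < k -> g (ext v x) = ext (g v) (x (+) c v)) ->
  g \in Aut_tree k /\ {in [pred v : vertex k | size v < k], active g =1 c}.
Proof.
move=> g0 gS.
have sg v : size (g v) = size v.
  elim/vertex_ind: v => [|v x sv IH]; first by rewrite g0.
  by rewrite gS // !val_ext ?IH // !size_rcons IH.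
have childE u v : child u v -> exists x, size u < k /\ v = ext u x.
  case/existsP=> x /eqP vE; exists x; split.
    by have := size_bseq v; rewrite vE size_rcons.
  by apply: val_inj; rewrite /ext -vE insub_vertexK.
have child_ext u x : size u < k -> child u (ext u x).
  by move=> su; apply/existsP; exists x; rewrite val_ext.
have gch u v : child (g u) (g v) = child u v.
  apply/idP/idP => [|/childE[x [su ->]]]; last by rewrite gS // child_ext ?sg.
  elim/vertex_ind: v => [|v x sv _].
    by rewrite g0 => /existsP[x]; case: (g u : seq bool).
  rewrite gS // => /childE[y []]; rewrite sg => su /ext_inj[]; rewrite ?sg //.
  by move/perm_inj=> <- _; apply: child_ext.
have gA : g \in Aut_tree k.
  rewrite inE g0 eqxx; apply/'forall_forallP=> u v.
  by rewrite /adj !gch.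
split=> // v /= sv; have := gS v false sv.
by rewrite Aut_ext // => /ext_inj[]; rewrite ?sg.
Qed.

(** The vertex permutations at the vertices of level less than l determine the
    action up to level l. *)
Lemma eq_Aut_level l g h : g \in Aut_tree k -> h \in Aut_tree k ->
    (forall v, size v < l -> active g v = active h v) ->
  forall v, size v <= l -> g v = h v.
Proof.
move=> gA hA gh v; elim/vertex_ind: v => [|v x sv IH]; first by rewrite !Aut_root.
by rewrite val_ext // size_rcons => lv; rewrite !Aut_ext // gh // IH // ltnW.
Qed.

(** Ancestors follow their descendants: the image of a child determines the image
    of its parent, then the vertex permutation there. *)
Lemma Aut_level_up l g h : l <= k -> g \in Aut_tree k -> h \in Aut_tree k ->
    {in level k l, g =1 h} ->
  forall v, size v <= l ->
    g v = h v /\ (size v < l -> active g v = active h v).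
Proof.
move=> lk gA hA gh v sv.
have [d] := ubnPeq (l - size v); elim: d v sv => [|d IH] v sv.
  rewrite eqn_leq leqn0 subn_eq0 => /andP[lv _].
  have -> : g v = h v by apply: gh; rewrite inE eqn_leq sv.
  by split=> //; rewrite ltnNge lv.
move=> /eqP dE; have ltv : size v < l by rewrite -subn_gt0 dE.
have ltvk := leq_trans ltv lk.
have [] := IH (ext v false); rewrite ?val_ext ?size_rcons // ?subnS ?dE //.
rewrite !Aut_ext // => + _ => /ext_inj[]; rewrite ?Aut_size //.
Qed.

(** * The automorphism with given active vertices *)

(** The image of a word under the automorphism whose active vertices are the
    elements of A: each letter is flipped when the prefix before it is in A. *)
Definition switch_word A w : seq bool :=
  mkseq (fun i => nth false w i (+) (insub_bseq k (take i w) \in A)) (size w).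

Lemma switch_word_rcons A w x :
  switch_word A (rcons w x) =
  rcons (switch_word A w) (x (+) (insub_bseq k w \in A)).
Proof.
rewrite /switch_word size_rcons mkseqS nth_rcons ltnn eqxx.
rewrite -[rcons w x]cats1 take_size_cat //; congr rcons.
apply/eq_in_map=> i; rewrite mem_iota /= add0n => lti.
by rewrite nth_cat lti takel_cat // ltnW.
Qed.

Definition switch A v : vertex k := insub_bseq k (switch_word A v).

Lemma size_switch A v : size (switch A v) = size v.
Proof. by rewrite val_insub_vertex size_mkseq ?size_bseq. Qed.

Lemma switch_ext A v x : size v < k ->
  switch A (ext v x) = ext (switch A v) (x (+) (v \in A)).
Proof.
move=> sv; apply: val_inj; rewrite /= !val_ext ?size_switch //.
rewrite !val_insub_vertex ?size_mkseq ?size_bseq ?size_rcons //.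
by rewrite switch_word_rcons insub_vertexK.
Qed.

Lemma switch_inj A : injective (switch A).
Proof.
move=> u; elim/vertex_ind: u => [|u x su IH] v E.
  apply/esym/val_inj/eqP; rewrite /= -size_eq0 -(size_switch A) -E.
  by rewrite size_switch.
have := size_switch A v; rewrite -E size_switch val_ext // size_rcons.
elim/vertex_ind: v E => [//|v y sv _].
rewrite !switch_ext // => + _ => /ext_inj[]; rewrite ?size_switch // => /IH->.
by move/addIb->.
Qed.

Definition portrait_perm A : {perm vertex k} := perm (@switch_inj A).

Lemma portrait_perm_ext A v x : size v < k ->
  portrait_perm A (ext v x) = ext (portrait_perm A v) (x (+) (v \in A)).
Proof. by move=> sv; rewrite !permE switch_ext. Qed.

Lemma portrait_perm_root A : portrait_perm A [bseq] = [bseq].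
Proof. by apply/val_inj/eqP; rewrite permE /= -size_eq0 size_switch. Qed.

Lemma portrait_perm_Aut A : portrait_perm A \in Aut_tree k.
Proof.
by case: (@Aut_treeI _ (mem A) (portrait_perm_root A) (@portrait_perm_ext A)).
Qed.

Lemma active_portrait A v : size v < k ->
  active (portrait_perm A) v = (v \in A).
Proof.
case: (@Aut_treeI _ (mem A) (portrait_perm_root A) (@portrait_perm_ext A)).
by move=> _; apply.
Qed.

Lemma active_size g v : active g v -> size v < k.
Proof. by case/andP. Qed.

Lemma portraitK g : g \in Aut_tree k -> portrait_perm (active_set g) = g.
Proof.
move=> gA; apply/permP=> v.
apply: (@eq_Aut_level k); rewrite ?portrait_perm_Aut ?size_bseq // => u su.
by rewrite active_portrait // inE.
Qed.

Lemma active_set_portrait A :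
  A \subset [set v : vertex k | size v < k] -> active_set (portrait_perm A) = A.
Proof.
move=> /subsetP sA; apply/setP=> v; rewrite inE.
apply/idP/idP => [av | vA].
  by rewrite -active_portrait // (active_size av).
by have := sA v vA; rewrite inE => sv; rewrite active_portrait.
Qed.

Lemma card_level_le l : l <= k -> #|level k l| = 2 ^ l.
Proof.
move=> lk; pose f (t : l.-tuple bool) : vertex k := insub_bseq k t.
have vf t : f t = t :> seq bool by rewrite val_insub_vertex ?size_tuple.
have injf : injective f.
  move=> s t /(congr1 (fun z : vertex k => z : seq bool)).
  by rewrite !vf => /val_inj.
have -> : level k l = f @: setT.
  apply/setP=> v; rewrite inE; apply/idP/imsetP=> [sv|[t _ ->]].
    by exists (Tuple sv); rewrite // /f insub_vertexK.
  by rewrite vf size_tuple.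
by rewrite card_imset // cardsT card_tuple card_bool.
Qed.

(** The automorphisms correspond to the sets of vertices of level less than k,
    and these vertices number 1 + 2 + ... + 2 ^ (k - 1). *)
Lemma card_Aut_tree : #|Aut_tree k| = 2 ^ (2 ^ k).-1.
Proof.
pose I := [set v : vertex k | size v < k].
have -> : Aut_tree k = portrait_perm @: powerset I.
  apply/setP=> g; apply/idP/imsetP=> [gA | [A _ ->]]; last exact: portrait_perm_Aut.
  exists (active_set g); last by rewrite portraitK.
  by rewrite inE; apply/subsetP=> v; rewrite !inE => /active_size.
rewrite card_in_imset => [|A A']; last first.
  by rewrite !inE => /active_set_portrait + /active_set_portrait => {2}<- {2}<- ->.
rewrite card_powerset; congr (2 ^ _).
have IE : I = ~: level k k.
  by apply/setP=> v; rewrite !inE ltn_neqAle size_bseq andbT.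
have := cardsC (level k k); rewrite -IE card_level_le // card_bseq card_bool.
by rewrite big_ord_recr /= addnC => /addIn->; rewrite predn_exp mul1n.
Qed.

(** * Automorphisms active only on the last inner level *)

Local Notation M := (level k k.-1).
Local Notation L := (level k k).

Lemma level_ext v : v \in L -> 0 < k ->
  exists u x, [/\ u \in M, size u < k & v = ext u x].
Proof.
rewrite inE => + k0; elim/vertex_ind: v => [|u x su _].
  by move=> /eqP k_0; rewrite -k_0 in k0.
rewrite val_ext // size_rcons => /eqP sk; exists u, x; split=> //.
by rewrite inE -[_ == _]eqSS prednK // sk.
Qed.

Lemma size_pred_level v : 0 < k -> v \in M -> size v < k.
Proof. by move=> k0; rewrite inE => /eqP->; rewrite prednK. Qed.

Lemma ext_leaf u x : 0 < k -> u \in M -> ext u x \in L.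
Proof.
move=> k0 uM; rewrite inE val_ext ?size_pred_level // size_rcons.
by rewrite inE in uM; rewrite (eqP uM) prednK.
Qed.

Lemma Aut_astabs_level l : Aut_tree k \subset 'N(level k l | 'P)%g.
Proof.
apply/subsetP=> g gA; apply/astabsP=> v.
by rewrite !inE /= apermE Aut_size.
Qed.

Lemma portrait_low A v : A \subset M -> size v < k -> portrait_perm A v = v.
Proof.
move=> /subsetP sA sv; rewrite -[RHS]perm1.
apply: (@eq_Aut_level k.-1); rewrite ?portrait_perm_Aut ?group1 //; last first.
  by rewrite -ltnS (ltn_predK sv).
move=> u su; have suk : size u < k by apply: leq_trans su (leq_pred _).
rewrite active_portrait // /active suk /=.
have -> : (u \in A) = false.
  by apply: contraTF su => /sA; rewrite inE => /eqP->; rewrite ltnn.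
apply/esym/existsP=> -[x]; rewrite /Defs.section perm1 val_insub_vertex.
  by rewrite drop_size_cat ?eqxx.
by rewrite size_cat addn1.
Qed.

Lemma portrait_leaf A u x : A \subset M -> size u < k ->
  portrait_perm A (ext u x) = ext u (x (+) (u \in A)).
Proof. by move=> sA su; rewrite portrait_perm_ext // portrait_low. Qed.

Lemma restr_portrait A : 0 < k ->
  A \subset M -> restr_perm L (portrait_perm A) = portrait_perm A.
Proof.
move=> k0 sA; apply/permP=> v; have [vL | vL] := boolP (v \in L).
  by rewrite restr_permE // (subsetP (Aut_astabs_level k)) ?portrait_perm_Aut.
rewrite (out_perm (restr_perm_on _ _) vL) portrait_low //.
by rewrite inE in vL; rewrite ltn_neqAle vL size_bseq.
Qed.

Lemma portrait_perm0 : portrait_perm set0 = 1%g.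
Proof.
apply/permP=> v; rewrite perm1; elim/vertex_ind: v => [|v x sv IH].
  exact: portrait_perm_root.
by rewrite portrait_perm_ext // IH inE addbF.
Qed.

(** An automorphism that is active only just above the leaves is a product of
    disjoint transpositions of sibling leaves, one for each active vertex. *)
Lemma odd_portrait A : 0 < k -> A \subset M ->
  portrait_perm A = odd #|A| :> bool.
Proof.
move=> k0; have [n] := ubnPeq #|A|; elim: n A => [|n IH] A.
  by rewrite cards_eq0 => /eqP-> _; rewrite portrait_perm0 odd_perm1.
move=> cA sA; have /card_gt0P[v vA] : 0 < #|A| by rewrite (eqP cA).
have sv := size_pred_level k0 (subsetP sA v vA).
have sA' : A :\ v \subset M := subset_trans (subD1set _ _) sA.
have cA' : #|A| = #|A :\ v|.+1 by rewrite (cardsD1 v) vA.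
have neq_vv : ext v false != ext v true.
  by apply/eqP=> /ext_inj[].
suff -> : portrait_perm A
    = (tperm (ext v false) (ext v true) * portrait_perm (A :\ v))%g.
  by rewrite odd_mul_tperm neq_vv (IH _ _ sA') // -eqSS -cA'.
apply/permP=> w; rewrite permM; have [wL | wL] := boolP (w \in L); last first.
  have sw : size w < k by rewrite inE in wL; rewrite ltn_neqAle wL size_bseq.
  rewrite tpermD ?(portrait_low sA) ?(portrait_low sA') //;
    by apply: contraNneq wL => <-; rewrite ext_leaf // (subsetP sA).
have [u [x [uM su ->]]] := level_ext wL k0.
rewrite portrait_leaf //; have [-> | neq_uv] := eqVneq u v.
  rewrite vA; case: x; rewrite ?tpermL ?tpermR portrait_leaf //;
    by rewrite !inE eqxx.
rewrite tpermD; last 2 first.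
- by apply: contraNneq neq_uv => /ext_inj[]// ->.
- by apply: contraNneq neq_uv => /ext_inj[]// ->.
by rewrite portrait_leaf // !inE neq_uv.
Qed.

Lemma odd_leaves_low g : 0 < k -> g \in Aut_tree k -> active_set g \subset M ->
  restr_perm L g = odd #|active_set g| :> bool.
Proof.
move=> k0 gA sgM.
by rewrite -{1}(portraitK gA) restr_portrait // odd_portrait.
Qed.

(** * Automorphisms that keep the last letter of every leaf *)

Definition false_leaves : {set vertex k} := [set ext u false | u in M].

Lemma mem_false_leaves u x : 0 < k -> u \in M ->
  (ext u x \in false_leaves) = ~~ x.
Proof.
move=> k0 uM; apply/imsetP/idP=> [[v vM] | nx]; last first.
  by exists u => //; case: x nx.
by case/ext_inj; rewrite ?size_pred_level // => _ ->.
Qed.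

Lemma Aut_level g v l : g \in Aut_tree k ->
  (g v \in level k l) = (v \in level k l).
Proof. by move=> gA; rewrite !inE Aut_size. Qed.

(** An automorphism sends the leaf ext v false to a child of its image of v, and
    v is active exactly when this child is the one along true. *)
Lemma B_sub_astabs : 0 < k -> B_sub k = 'N_(Aut_tree k)(false_leaves | 'P)%g.
Proof.
move=> k0; apply/setP=> g; rewrite [LHS]inE [RHS]inE.
have [gA /= | //] := boolP (g \in Aut_tree k).
have gF v : v \in M -> (g (ext v false) \in false_leaves) = ~~ active g v.
  move=> vM; rewrite Aut_ext ?size_pred_level // mem_false_leaves ?Aut_level //.
apply/forall_inP/idP=> [nact | /astabsP gS v vM].
  rewrite 3!inE; apply/subsetP=> _ /imsetP[v vM ->].
  by rewrite inE /= apermE gF // nact.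
by rewrite -gF // -[g _]apermE gS mem_false_leaves.
Qed.

(** Flipping the last letter of all leaves conjugates the action on the leaves
    ending in false to the action on the leaves ending in true, so both have
    the same parity. *)
Lemma B_sub_even g : 0 < k -> g \in B_sub k -> even_on_leaves g.
Proof.
move=> k0 gB; have:= gB; rewrite inE => /andP[gA /forall_inP nact].
have gF : g \in 'N(false_leaves | 'P)%g.
  by move: gB; rewrite B_sub_astabs // => /setIP[].
(* f flips the last letter of every leaf *)
pose f := portrait_perm M; pose s := restr_perm false_leaves g.
have ext_f u x : u \in M -> ext u x = f (ext u (~~ x)).
  by move=> uM; rewrite portrait_leaf ?size_pred_level // uM addbT negbK.
have sE v : v \notin false_leaves -> s v = v by apply: out_perm (restr_perm_on _ _).
have gE u x : u \in M -> g (ext u x) = ext (g u) x.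
  by move=> uM; rewrite Aut_ext ?size_pred_level // (negPf (nact _ uM)) addbF.
have sF u : u \in M -> s (ext u false) = ext (g u) false.
  by move=> uM; rewrite restr_permE ?gE // mem_false_leaves.
rewrite /even_on_leaves; suff -> : restr_perm L g = (s * s ^ f)%g.
  by rewrite odd_permM odd_permJ addbb.
apply/permP=> v; rewrite permM; have [vL | vL] := boolP (v \in L).
  rewrite restr_permE ?(subsetP (Aut_astabs_level k)) //.
  have [u [[] [uM su ->]]] := level_ext vL k0; rewrite gE //.
    by rewrite sE ?mem_false_leaves // !(ext_f _ true) ?Aut_level // permJ sF.
  have guM : g u \in M by rewrite Aut_level.
  by rewrite sF // (ext_f (g u)) // permJ sE ?mem_false_leaves.
have sv : size v < k by rewrite inE in vL; rewrite ltn_neqAle vL size_bseq.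
have vF : v \notin false_leaves.
  by apply: contra vL => /imsetP[u uM ->]; rewrite ext_leaf.
rewrite (out_perm (restr_perm_on _ _) vL) sE //.
have {2}<- : f v = v by rewrite portrait_low.
by rewrite permJ sE // portrait_low.
Qed.

(** * The group of even automorphisms *)

Definition even_Aut : {set {perm vertex k}} :=
  [set g in Aut_tree k | even_on_leaves g].

Lemma even_AutE g :
  (g \in even_Aut) = (g \in Aut_tree k) && even_on_leaves g.
Proof. by rewrite inE. Qed.

Lemma even_Aut_sub : even_Aut \subset Aut_tree k.
Proof. by apply/subsetP=> g; rewrite even_AutE => /andP[]. Qed.

Lemma even_Aut_group_set : group_set even_Aut.
Proof.
apply/group_setP; split.
  by rewrite even_AutE group1 /even_on_leaves morph1 odd_perm1.
move=> g h; rewrite !even_AutE => /andP[gA ge] /andP[hA he].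
have sN := subsetP (Aut_astabs_level k).
by rewrite groupM //= /even_on_leaves morphM ?sN // odd_permM (negPf ge).
Qed.
Canonical even_Aut_group := Group even_Aut_group_set.

(** No vertex above level k - 1 can be active when that level is fixed pointwise,
    since the ancestors of its vertices are then fixed as well. *)
Lemma astab_pred_level g : 0 < k -> g \in Aut_tree k ->
  (g \in 'C(M | 'P)%g) = (active_set g \subset M).
Proof.
move=> k0 gA; apply/astabP/subsetP=> [gM v | /subsetP sM v vM].
  rewrite inE => av; have sv : size v <= k.-1.
    by rewrite -ltnS prednK // (active_size av).
  rewrite inE eqn_leq sv leqNgt.
  have [| _ gv] := @Aut_level_up k.-1 g 1%g (leq_pred _) gA (group1 _) _ v sv.
    by move=> u uM; rewrite perm1 -[RHS](gM u uM) /= apermE.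
  apply: contraL av => /gv->.
  have -> : active (1%g : {perm vertex k}) v = active (portrait_perm set0) v.
    by rewrite portrait_perm0.
  by rewrite active_portrait ?inE // (leq_ltn_trans sv) ?prednK.
by rewrite /= apermE -(portraitK gA) portrait_low ?size_pred_level.
Qed.

Lemma W_sub_astab : 0 < k -> W_sub k = 'C_even_Aut(M | 'P)%g.
Proof.
move=> k0; apply/setP=> g; rewrite [LHS]inE [RHS]inE even_AutE.
have [gA /= | //] := boolP (g \in Aut_tree k).
rewrite astab_pred_level // andbC; apply: andb_id2r => sM.
by rewrite /even_on_leaves odd_leaves_low.
Qed.

(** W_{k-1} is normal as the kernel of the action of the even automorphisms on
    level k - 1, and B_{k-1} supplements it because every action on that level
    comes from an element of B_{k-1}. *)
Lemma sdprod_even_Aut : 0 < k -> (W_sub k ><| B_sub k)%g = even_Aut.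
Proof.
move=> k0; have sBE : B_sub k \subset even_Aut.
  apply/subsetP=> g gB; rewrite inE B_sub_even //.
  by move: gB; rewrite inE => /andP[->].
have sEA := even_Aut_sub.
have [WE BE] := (W_sub_astab k0, B_sub_astabs k0).
rewrite [in LHS]WE [in LHS]BE sdprodE /= -?BE -?WE.
- apply/eqP; rewrite eqEsubset; apply/andP; split.
    by rewrite -[even_Aut]mulGid /= mulgSS // WE subsetIl.
  apply/subsetP=> g gE; have gA := subsetP sEA g gE.
  (* b agrees with g up to level k - 1 and keeps the last letter of each leaf *)
  pose b := portrait_perm (active_set g :\: M).
  have bA : b \in Aut_tree k by apply: portrait_perm_Aut.
  have bB : b \in B_sub k.
    rewrite inE bA; apply/forall_inP=> v vM.
    by rewrite active_portrait ?size_pred_level // inE vM.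
  have gb : (g * b^-1)%g \in 'C(M | 'P)%g.
    apply/astabP=> v vM; rewrite /= apermE permM -[RHS](permK b).
    congr (_ _); apply: (@eq_Aut_level k.-1) => //; last first.
      by rewrite inE in vM; rewrite (eqP vM).
    move=> u su; have suk : size u < k := leq_trans su (leq_pred _).
    by rewrite active_portrait // !inE (ltn_eqF su).
  rewrite -[g](mulgKV b) mem_mulg // WE in_setI gb andbT.
  by rewrite groupM // groupV (subsetP sBE).
- rewrite WE; apply: normsI; first exact: subset_trans sBE (normG _).
  apply: subset_trans (astab_norm _ _).
  exact: subset_trans (subset_trans sBE sEA) (Aut_astabs_level _).
rewrite WE BE; apply/trivgP; rewrite /= -WE -BE; apply/subsetP=> g.
rewrite inE => /andP[]; rewrite inE => /and3P[gA /subsetP sM _].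
rewrite inE => /andP[_ /forall_inP nact]; rewrite -(portraitK gA).
have -> : active_set g = set0.
  apply/setP=> v; rewrite [RHS]inE; apply/negP=> av.
  by have := nact v (sM v av); rewrite inE in av; rewrite av.
by rewrite portrait_perm0 inE.
Qed.

(** A single active vertex just above the leaves gives an odd automorphism, so
    the even ones have index two. *)
Lemma card_even_Aut : 0 < k -> #|even_Aut| = 2 ^ (2 ^ k).-2.
Proof.
move=> k0; have /card_gt0P[v vM] : 0 < #|M|.
  by rewrite card_level_le ?leq_pred ?expn_gt0.
have sE g : (g \in even_Aut) = (g \in Aut_tree k) && ~~ (restr_perm L g).
  by rewrite inE.
pose t := portrait_perm [set v].
have tA : t \in Aut_tree k by apply: portrait_perm_Aut.
have t1 : odd_perm (restr_perm L t).
  by rewrite restr_portrait ?odd_portrait ?cards1 ?sub1set.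
have sN := subsetP (Aut_astabs_level k).
have EC : (even_Aut :* t)%g = Aut_tree k :\: even_Aut.
  apply/setP=> g; rewrite mem_rcoset in_setD !sE groupMr ?groupV //.
  have [gA | //] := boolP (g \in Aut_tree k).
  rewrite morphM ?morphV ?groupV ?sN // odd_permM odd_permV t1 addbT /=.
  by rewrite !negbK andbT.
have sEA := even_Aut_sub.
have : #|Aut_tree k| = 2 * #|even_Aut|.
  rewrite -(cardsID even_Aut) (setIidPr sEA) -EC card_rcoset.
  by rewrite mul2n addnn.
rewrite card_Aut_tree; have : 1 < 2 ^ k by rewrite -{1}(expn0 2) ltn_exp2l.
case: (2 ^ k) => [|[|n]] // _; rewrite /= expnS => /eqP.
by rewrite eqn_pmul2l // => /eqP.
Qed.

Lemma even_2subgroup_even_Aut : 0 < k -> even_2subgroup even_Aut.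
Proof.
move=> k0; apply/and3P; split.
- exact: even_Aut_sub.
- by rewrite /pgroup card_even_Aut // pnatX pnat_id.
- by apply/forall_inP=> g; rewrite inE => /andP[].
Qed.

Lemma even_2subgroup_sub (G : {group {perm vertex k}}) :
  even_2subgroup G -> G \subset even_Aut.
Proof.
case/and3P=> /subsetP sGA _ /forall_inP Ge.
by apply/subsetP=> g gG; rewrite inE sGA ?Ge.
Qed.

End Portraits.

(** * Relabelling the leaves by ordinals *)

(** Parity is intrinsic: adding fixed points and renaming the points moved does
    not affect a decomposition into transpositions. *)
Lemma odd_perm_embed (S T : finType) (f : S -> T)
    (s : {perm S}) (t : {perm T}) :
    injective f -> (forall x, t (f x) = f (s x)) ->
    (forall y, y \notin codom f -> t y = y) ->
  t = s :> bool.
Proof.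
move=> injf; have [ts -> _] := prod_tpermP s; elim: ts t => [|[x y] ts IH] t.
  rewrite big_nil => tf tC; suff -> : t = 1%g by rewrite !odd_perm1.
  apply/permP=> z; rewrite perm1.
  have [/codomP[i ->] | /tC//] := boolP (z \in codom f).
  by rewrite tf perm1.
rewrite big_cons /=; set p := (\prod_(_ <- _) _)%g in IH * => tf tC.
suff : (tperm (f x) (f y) * t)%g = p :> bool.
  by rewrite !odd_mul_tperm (inj_eq injf) => <-; rewrite addKb.
apply: IH => [z|]; first by rewrite permM -inj_tperm // tf permM tpermK.
move=> z zC; rewrite permM tpermD ?tC //.
  by apply: contraNneq zC => <-; apply: codom_f.
by apply: contraNneq zC => <-; apply: codom_f.
Qed.

Section Relabel.

Variables (T : finType) (A : {set T}) (n : nat) (cardA : #|A| = n).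

Definition label (i : 'I_n) : T := enum_val (cast_ord (esym cardA) i).

Lemma label_inj : injective label.
Proof. by move=> i j /enum_val_inj/cast_ord_inj. Qed.

Lemma mem_codom_label x : (x \in codom label) = (x \in A).
Proof.
apply/codomP/idP=> [[i ->] | xA]; first exact: enum_valP.
exists (cast_ord cardA (enum_rank_in xA x)).
by rewrite /label cast_ordK enum_rankK_in.
Qed.

Lemma relabel_subproof (g : {perm T}) i :
  exists j, label j == restr_perm A g (label i).
Proof.
suff /codomP[j ->] : restr_perm A g (label i) \in codom label by exists j.
rewrite mem_codom_label perm_closed ?restr_perm_on //.
by rewrite -mem_codom_label codom_f.
Qed.

Definition relabel_fun (g : {perm T}) i := xchoose (relabel_subproof g i).

Lemma label_relabel_fun (g : {perm T}) i :
  label (relabel_fun g i) = restr_perm A g (label i).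
Proof. exact/eqP/(xchooseP (relabel_subproof g i)). Qed.

Lemma relabel_fun_inj (g : {perm T}) : injective (relabel_fun g).
Proof.
move=> i j /(congr1 label); rewrite !label_relabel_fun.
by move/perm_inj/label_inj.
Qed.

(** The permutation of the labels of A induced by g, which is a morphism on the
    stabiliser of A. Going through restr_perm defines it for every g, the value
    being 1 when g does not stabilise A. *)
Definition relabel (g : {perm T}) : {perm 'I_n} := perm (@relabel_fun_inj g).

Lemma label_relabel (g : {perm T}) i :
  label (relabel g i) = restr_perm A g (label i).
Proof. by rewrite permE label_relabel_fun. Qed.

Lemma relabelM : {in 'N(A | 'P)%g &, {morph relabel : g h / (g * h)%g}}.
Proof.
move=> g h gN hN; apply/permP=> i; apply: label_inj.
by rewrite permM !label_relabel morphM // permM.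
Qed.

Lemma odd_relabel g : relabel g = restr_perm A g :> bool.
Proof.
symmetry; apply: (odd_perm_embed label_inj) => [i | x].
  by rewrite label_relabel.
by rewrite mem_codom_label; apply: out_perm (restr_perm_on _ _).
Qed.

Lemma relabel1_fix g : g \in 'N(A | 'P)%g -> relabel g = 1%g -> {in A, g =1 id}.
Proof.
move=> gN g1 x xA; rewrite -(restr_permE gN xA).
have /codomP[i ->] : x \in codom label by rewrite mem_codom_label.
by rewrite -label_relabel g1 perm1.
Qed.

End Relabel.

(** * The Sylow 2-subgroups of the alternating group *)

(** In Legendre's formula the term of index i, for i from 1 to k, is 2 ^ (k - i),
    and the later terms vanish. *)
Lemma logn2_fact_expn k : logn 2 (2 ^ k)`! = (2 ^ k).-1.
Proof.
rewrite logn_fact // (big_cat_nat (n := k.+1)) //=; last first.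
  by rewrite ltnS ltnW // ltn_expl.
rewrite [X in _ + X]big1_seq ?addn0; last first.
  move=> i /andP[_]; rewrite mem_index_iota => /andP[ki _].
  by rewrite divn_small // ltn_exp2l.
rewrite big_add1 /= big_mkord predn_exp mul1n (reindex_inj rev_ord_inj) /=.
apply: eq_bigr => i _; rewrite subnSK // -expnB ?leq_subr //.
by rewrite subKn // ltnW.
Qed.

Lemma card_Sylow2_Alt k : 1 < k -> #|('Alt_('I_(2 ^ k)))%g|`_2 = 2 ^ (2 ^ k).-2.
Proof.
move=> k1; have k0 := ltnW k1.
have lt1 : 1 < #|'I_(2 ^ k)| by rewrite card_ord -{1}(expn0 2) ltn_exp2l.
have := congr1 (logn 2) (card_Alt lt1); rewrite card_ord logn2_fact_expn.
by rewrite p_part lognM ?cardG_gt0 // logn_prime //= add1n => <-.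
Qed.

(** The action on the leaves is faithful because a vertex is determined by any
    leaf below it, so the order of the image decides whether it is Sylow. *)
Lemma even_Aut_isog_Sylow k : 1 < k ->
  exists2 P : {group {perm 'I_(2 ^ k)}},
    (2.-Sylow('Alt_('I_(2 ^ k))) P)%g & even_Aut k \isog P.
Proof.
move=> k1; have k0 := ltnW k1.
pose r := relabel (card_level_le (leqnn k)).
have sEN g : g \in even_Aut k -> g \in 'N(level k k | 'P)%g.
  by move/(subsetP (even_Aut_sub k))/(subsetP (Aut_astabs_level k k)).
have rM : {in even_Aut k &, {morph r : g h / (g * h)%g}}.
  by move=> g h gE hE; apply: relabelM; apply: sEN.
pose phi := Morphism rM.
have inj_phi : ('injm phi)%g.
  apply/subsetP=> g /morphpreP[gE /set1P g1]; apply/set1P/permP=> v.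
  have gA := subsetP (even_Aut_sub k) g gE.
  have [|//] :=
    @Aut_level_up k k g 1%g (leqnn k) gA (group1 _) _ v (size_bseq v).
  by move=> u uL; rewrite perm1 (relabel1_fix (sEN g gE) g1).
have iso : even_Aut k \isog phi @* even_Aut k by apply: sub_isog.
exists (phi @* even_Aut k)%G => //.
rewrite pHallE -(card_isog iso) card_even_Aut // card_Sylow2_Alt // eqxx andbT.
apply/subsetP=> _ /morphimP[g _ gE ->].
by rewrite Alt_even odd_relabel; move: gE; rewrite even_AutE => /andP[].
Qed.

Theorem theorem1 (k : nat) (k_ge2 : 2 <= k) (G : {group {perm vertex k}})
    (maxG : [max G | even_2subgroup G]%g) :
  (exists2 H : {group {perm vertex k}},
      (W_sub k ><| B_sub k)%g = H & G \isog H) /\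
  (exists2 P : {group {perm 'I_(2 ^ k)}},
      (2.-Sylow('Alt_('I_(2 ^ k))) P)%g & G \isog P).
Proof.
have k0 : 0 < k := ltnW k_ge2.
case/maxgroupP: maxG => Geven Gmax.
have <- : even_Aut_group k = G.
  apply/group_inj/Gmax; first exact: even_2subgroup_even_Aut.
  exact: even_2subgroup_sub.
split; last exact: even_Aut_isog_Sylow.
by exists (even_Aut_group k); [apply: sdprod_even_Aut | apply: isog_refl].
Qed.
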